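(* Let $H(x,p)=\frac12\langle A(x)p,p\rangle+V(x)$ be a mechanical Hamiltonian on $\mathbb{T}^n\times\mathbb{R}^n$, let $c\in\mathbb{R}^n$, let $u_c$ be a $\mathbb{T}^n$-periodic viscosity solution of $H(x,c+Du_c(x))=\alpha_H(c)$, let $v_c(x)=\langle c,x\rangle+u_c(x)$ on $\mathbb{R}^n$, and let $\Phi_t$ be the associated semiflow of generalized characteristics on $\mathbb{R}^n$. If the regular values of $v_c$ are dense in $\mathbb{R}$, then $\mathcal{R}(\Phi_t)\subset \mathrm{Crit}(v_c)$. In particular, $$L(\Phi_t):=\mathrm{cl}\Big(\bigcup\{\omega(\Phi_t,x):x\in\mathbb{R}^n\}\Big)=\Omega(\Phi_t)=\mathcal{R}(\Phi_t)=\mathrm{Crit}(v_c).$$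
   Context: Setting: $\mathbb{T}^n=\mathbb{R}^n/\mathbb{Z}^n$; $A$ is a $C^2$ map from $\mathbb{T}^n$ to the positive definite symmetric real $n\times n$ matrices; $V:\mathbb{T}^n\to\mathbb{R}$ is $C^2$ with $\max V=0$. All functions on $\mathbb{T}^n$ are also viewed as $\mathbb{Z}^n$-periodic functions on $\mathbb{R}^n$. $\alpha_H(c)$ (Mather's $\alpha$-function) is the unique real number for which $H(x,c+Du(x))=\alpha_H(c)$ has a $\mathbb{T}^n$-periodic viscosity solution. Such a solution is Lipschitz and semiconcave. Superdifferential: $D^+v(x)=\{p\in\mathbb{R}^n:\limsup_{y\to x}\frac{v(y)-v(x)-\langle p,y-x\rangle}{|y-x|}\le 0\}$. $\mathrm{Crit}(v_c)=\{x\in\mathbb{R}^n:0\in D^+v_c(x)\}$ is the set of critical points of $v_c$; other points are regular points. A real number $r$ is a regular value of $v_c$ if $v_c^{-1}(r)$ contains no critical point. Semiflow: for each $x\in\mathbb{R}^n$ there is a unique Lipschitz arc $\mathbf{x}:[0,\infty)\to\mathbb{R}^n$ with $\mathbf{x}(0)=x$ and $\dot{\mathbf{x}}(s)\in A(\mathbf{x}(s))D^+v_c(\mathbf{x}(s))$ for a.e. $s$ (the generalized characteristic from $x$); $\Phi_t(x):=\mathbf{x}(t)$ is a (continuous) semiflow on $\mathbb{R}^n$. Limit sets: $\omega(\Phi_t,x)$ is the $\omega$-limit set of the semi-orbit of $x$. $\Omega(\Phi_t)$ is the non-wandering set: the set of $x$ such that for every neighborhood $U$ of $x$ and every $T>0$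 there is $t\ge T$ with $\Phi_t(U)\cap U\ne\emptyset$. Chain recurrence: for a continuous function $\varepsilon:\mathbb{R}^n\to(0,\infty)$ and $T>0$, an $(\varepsilon,T)$-chain of length $m$ from $x$ to $y$ consists of points $x_0=x,x_1,\dots,x_m=y$ and times $t_0,\dots,t_{m-1}\ge T$ with $|\Phi_{t_j}(x_j)-x_{j+1}|<\varepsilon(\Phi_{t_j}(x_j))$ for $0\le j\le m-1$. A point $x$ is chain recurrent if for every such $\varepsilon$ and $T$ there is an $(\varepsilon,T)$-chain of length at least $1$ from $x$ to $x$; $\mathcal{R}(\Phi_t)$ is the set of chain recurrent points. *)

(* Defs.v *)
From HB Require Import structures.
From mathcomp Require Import all_boot all_order all_algebra.
From mathcomp Require Import all_classical all_reals all_analysis.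

Set Implicit Arguments.
Unset Strict Implicit.
Unset Printing Implicit Defensive.

Import Order.TTheory GRing.Theory Num.Theory.
Import numFieldNormedType.Exports.

Local Open Scope classical_set_scope.
Local Open Scope ring_scope.

(* Vectors of R^n are the row vectors 'rV[R]_n.  The norm `|x| that the library
   puts on them is the sup norm; [enorm] is the Euclidean one. *)
Definition dot (R : realType) (n : nat) (x y : 'rV[R]_n) : R :=
  \sum_(i < n) x 0 i * y 0 i.

Definition enorm (R : realType) (n : nat) (x : 'rV[R]_n) : R :=
  Num.sqrt (dot x x).

(* The vector M p, again written as a row. *)
Definition mxapp (R : realType) (n : nat) (M : 'M[R]_n) (p : 'rV[R]_n)
  : 'rV[R]_n := (M *m p^T)^T.

(* Functions on the torus R^n/Z^n are Z^n-periodic functions on R^n. *)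
Definition Zn_periodic (R : realType) (n : nat) (T : Type) (f : 'rV[R]_n -> T)
  : Prop :=
  forall (x : 'rV[R]_n) (k : 'rV[int]_n), f (x + map_mx intr k) = f x.

Definition basis_vec (R : realType) (n : nat) (i : 'I_n) : 'rV[R]_n :=
  delta_mx 0 i.

Definition classC1 (R : realType) (n : nat) (f : 'rV[R]_n -> R) : Prop :=
  forall i : 'I_n, (forall x, derivable f x (basis_vec R i)) /\
    continuous (fun x => 'D_(basis_vec R i) f x).

Definition classC2 (R : realType) (n : nat) (f : 'rV[R]_n -> R) : Prop :=
  classC1 f /\ forall i : 'I_n, classC1 (fun x => 'D_(basis_vec R i) f x).

Definition sym_posdef (R : realType) (n : nat) (M : 'M[R]_n) : Prop :=
  M^T = M /\ forall p : 'rV[R]_n, p != 0 -> 0 < dot (mxapp M p) p.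

Definition hamiltonian (R : realType) (n : nat) (A : 'rV[R]_n -> 'M[R]_n)
    (V : 'rV[R]_n -> R) (x p : 'rV[R]_n) : R :=
  2^-1 * dot (mxapp (A x) p) p + V x.

Definition diff_quot (R : realType) (n : nat) (v : 'rV[R]_n -> R)
    (x p y : 'rV[R]_n) : R :=
  (v y - v x - dot p (y - x)) / enorm (y - x).

(* D^+ v(x) and D^- v(x); x^' is the filter of punctured neighborhoods of x. *)
Definition superdiff (R : realType) (n : nat) (v : 'rV[R]_n -> R)
    (x : 'rV[R]_n) : set 'rV[R]_n :=
  [set p | (limf_esup (fun y => (diff_quot v x p y)%:E) x^' <= 0)%E].

Definition subdiff (R : realType) (n : nat) (v : 'rV[R]_n -> R)
    (x : 'rV[R]_n) : set 'rV[R]_n :=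
  [set p | (0 <= limf_einf (fun y => (diff_quot v x p y)%:E) x^')%E].

(* u is a continuous viscosity solution of G(x, Du(x)) = a. *)
Definition viscosity_solution (R : realType) (n : nat)
    (G : 'rV[R]_n -> 'rV[R]_n -> R) (a : R) (u : 'rV[R]_n -> R) : Prop :=
  [/\ continuous u,
      forall x p, superdiff u x p -> G x p <= a
    & forall x p, subdiff u x p -> a <= G x p].

(* u is a periodic viscosity solution of H(x, c + Du(x)) = a. *)
Definition cell_solution (R : realType) (n : nat)
    (H : 'rV[R]_n -> 'rV[R]_n -> R) (c : 'rV[R]_n) (a : R)
    (u : 'rV[R]_n -> R) : Prop :=
  Zn_periodic u /\ viscosity_solution (fun x p => H x (c + p)) a u.

(* Mather's alpha-function: the real number a for which the cell problem has a
   solution (the value 0 is used only if there is none). *)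
Definition mather_alpha (R : realType) (n : nat)
    (H : 'rV[R]_n -> 'rV[R]_n -> R) (c : 'rV[R]_n) : R :=
  xget 0 [set a : R | exists u, cell_solution H c a u].

Definition Crit (R : realType) (n : nat) (v : 'rV[R]_n -> R)
  : set 'rV[R]_n := [set x | superdiff v x 0].

Definition regular_value (R : realType) (n : nat) (v : 'rV[R]_n -> R) (r : R)
  : Prop := forall x, v x = r -> ~ Crit v x.

(* Arcs are defined on [0, +oo[: values at negative times are irrelevant. *)
Definition gen_characteristic (R : realType) (n : nat)
    (A : 'rV[R]_n -> 'M[R]_n) (v : 'rV[R]_n -> R) (x : 'rV[R]_n)
    (g : R -> 'rV[R]_n) : Prop :=
  [/\ g 0 = x,
      [lipschitz g s | s in [set s : R | 0 <= s]]
    & {ae (@lebesgue_measure R), forall s : R, 0 < s ->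
        exists2 p, superdiff v (g s) p & is_derive s 1 g (mxapp (A (g s)) p)}].

Definition semiflow (R : realType) (n : nat)
    (Phi : R -> 'rV[R]_n -> 'rV[R]_n) : Prop :=
  [/\ forall x, Phi 0 x = x,
      forall s t x, 0 <= s -> 0 <= t -> Phi (s + t) x = Phi s (Phi t x)
    & {within [set z : R * 'rV[R]_n | 0 <= z.1],
        continuous (fun z : R * 'rV[R]_n => Phi z.1 z.2)}].

(* Phi is the semiflow of generalized characteristics: for every x, the arc
   t |-> Phi t x is the unique generalized characteristic from x. *)
Definition characteristic_semiflow (R : realType) (n : nat)
    (A : 'rV[R]_n -> 'M[R]_n) (v : 'rV[R]_n -> R)
    (Phi : R -> 'rV[R]_n -> 'rV[R]_n) : Prop :=
  semiflow Phi /\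
  forall x, gen_characteristic A v x (fun t => Phi t x) /\
    forall g, gen_characteristic A v x g -> forall t, 0 <= t -> g t = Phi t x.

Definition omega_limit (R : realType) (n : nat)
    (Phi : R -> 'rV[R]_n -> 'rV[R]_n) (x : 'rV[R]_n) : set 'rV[R]_n :=
  \bigcap_(T in [set T : R | 0 <= T])
    closure [set Phi t x | t in [set t : R | T <= t]].

Definition limit_set (R : realType) (n : nat)
    (Phi : R -> 'rV[R]_n -> 'rV[R]_n) : set 'rV[R]_n :=
  closure (\bigcup_(x in [set: 'rV[R]_n]) omega_limit Phi x).

Definition nonwandering (R : realType) (n : nat)
    (Phi : R -> 'rV[R]_n -> 'rV[R]_n) : set 'rV[R]_n :=
  [set x | forall (U : set 'rV[R]_n) (T : R), nbhs x U -> 0 < T ->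
    exists2 t, T <= t & (Phi t @` U) `&` U !=set0].

Definition eps_chain (R : realType) (n : nat)
    (Phi : R -> 'rV[R]_n -> 'rV[R]_n) (eps : 'rV[R]_n -> R) (T : R) (m : nat)
    (x y : 'rV[R]_n) : Prop :=
  exists (xs : nat -> 'rV[R]_n) (ts : nat -> R),
    [/\ xs 0%N = x, xs m = y
      & forall j : nat, (j < m)%N -> T <= ts j /\
          enorm (Phi (ts j) (xs j) - xs j.+1) < eps (Phi (ts j) (xs j))].

Definition chain_recurrent (R : realType) (n : nat)
    (Phi : R -> 'rV[R]_n -> 'rV[R]_n) : set 'rV[R]_n :=
  [set x | forall (eps : 'rV[R]_n -> R) (T : R),
    continuous eps -> (forall y, 0 < eps y) -> 0 < T ->
    exists2 m : nat, (0 < m)%N & eps_chain Phi eps T m x x].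

(* Main.v *)
Require Import Defs.
From HB Require Import structures.
From mathcomp Require Import all_boot all_order all_algebra.
From mathcomp Require Import all_classical all_reals all_analysis.
From mathcomp Require Import measurable_realfun.
From mathcomp Require Import ring lra.

Set Implicit Arguments.
Unset Strict Implicit.
Unset Printing Implicit Defensive.

Import Order.TTheory GRing.Theory Num.Theory.
Import numFieldNormedType.Exports.

Local Open Scope classical_set_scope.
Local Open Scope ring_scope.

(* Along a characteristic x(t), at almost every t, x' = A p with p in D^+ v(x);
   comparing v(x(t - h)) with v(x(t)) through p gives (v o x)' >= <A p, p> >= 0
   from the left.  Hence v is nondecreasing along the flow, and it can be
   constant on an arc only if p = 0 almost everywhere, i.e. if the arc rests at
   a critical point: Crit(v) is exactly the set of fixed points.  The only
   regularity of v used is its Lipschitz continuity, which follows from the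
   coercivity of H.

   If x is chain recurrent and not critical, choose a regular value r between
   v(x) and v(Phi_1 x).  Phi_1 maps N = {v >= r} into {v > r}, and since arcs
   have bounded speed, v - r is bounded below by a positive constant on the part
   of Phi_1(N) in any bounded set.  So some positive continuous eps satisfies
   eps <= (v - r) / (Lip(v) + 1) on Phi_1(N), and an (eps, 2)-chain starting at x
   can never leave N after its first jump, hence cannot return to x. *)

(** * Vectors and superdifferentials *)

Lemma coord_le_norm (R : realType) (m n : nat) (x : 'M[R]_(m, n)) i j :
  `|x i j| <= `|x|.
Proof.
by rewrite [leRHS]/Num.Def.normr/= mx_normrE; exact: (le_bigmax _ _ (i, j)).
Qed.

Lemma norm_le_coord (R : realType) (n : nat) (x : 'rV[R]_n) (r : R) :
  0 <= r -> (forall i, `|x 0 i| <= r) -> `|x| <= r.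
Proof.
move=> r0 xr; rewrite [leLHS]/Num.Def.normr/= mx_normrE (bigmax_le _ r0)//=.
by move=> [i j] _; rewrite (ord1 i).
Qed.

Section Dot.
Context {R : realType} {n : nat}.
Implicit Types x y z p : 'rV[R]_n.

Lemma dotC x y : dot x y = dot y x.
Proof. by apply: eq_bigr => i _; rewrite mulrC. Qed.

Lemma dotDr x y z : dot x (y + z) = dot x y + dot x z.
Proof. by rewrite -big_split; apply: eq_bigr => i _; rewrite mxE mulrDr. Qed.

Lemma dotZr a x y : dot x (a *: y) = a * dot x y.
Proof. by rewrite mulr_sumr; apply: eq_bigr => i _; rewrite mxE mulrCA. Qed.

Lemma dotNr x y : dot x (- y) = - dot x y.
Proof. by rewrite -scaleN1r dotZr mulN1r. Qed.

Lemma dotBr x y z : dot x (y - z) = dot x y - dot x z.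
Proof. by rewrite dotDr dotNr. Qed.

Lemma dotZl a x y : dot (a *: x) y = a * dot x y.
Proof. by rewrite dotC dotZr dotC. Qed.

Lemma dotDl x y z : dot (x + y) z = dot x z + dot y z.
Proof. by rewrite dotC dotDr !(dotC z). Qed.

Lemma dotNl x y : dot (- x) y = - dot x y.
Proof. by rewrite dotC dotNr dotC. Qed.

Lemma dotBl x y z : dot (x - y) z = dot x z - dot y z.
Proof. by rewrite dotDl dotNl. Qed.

Lemma dot0l x : dot 0 x = 0.
Proof. by rewrite -(scale0r 0) dotZl mul0r. Qed.

Lemma dot0r x : dot x 0 = 0.
Proof. by rewrite dotC dot0l. Qed.

Lemma dot_norm x y : `|dot x y| <= n%:R * (`|x| * `|y|).
Proof.
apply: le_trans (ler_norm_sum _ _ _) _.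
rewrite -[n in n%:R]card_ord -sumr_const mulr_suml ler_sum// => i _.
by rewrite mul1r normrM ler_pM// coord_le_norm.
Qed.

Lemma dot_self_ge0 x : 0 <= dot x x.
Proof. by rewrite sumr_ge0// => i _; rewrite -expr2 sqr_ge0. Qed.

Lemma enorm_ge0 x : 0 <= enorm x.
Proof. exact: sqrtr_ge0. Qed.

Lemma enorm_sqr x : enorm x ^+ 2 = dot x x.
Proof. by rewrite sqr_sqrtr// dot_self_ge0. Qed.

Lemma norm_le_enorm x : `|x| <= enorm x.
Proof.
apply: norm_le_coord; rewrite ?enorm_ge0// => i.
rewrite -ler_sqr ?nnegrE ?enorm_ge0// enorm_sqr real_normK ?num_real//.
rewrite /dot (bigD1 i)//= -expr2 lerDl sumr_ge0// => j _.
by rewrite -expr2 sqr_ge0.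
Qed.

Lemma enorm_le_norm x : enorm x <= n%:R * `|x|.
Proof.
rewrite -ler_sqr ?nnegrE ?enorm_ge0 ?mulr_ge0//.
rewrite enorm_sqr (le_trans (ler_norm _))// (le_trans (dot_norm _ _))//.
rewrite -expr2 exprMn ler_wpM2r ?sqr_ge0// -natrX ler_nat.
by case: (n) => // k; rewrite expnS expn1 leq_pmulr.
Qed.

Lemma enorm0 : enorm (0 : 'rV[R]_n) = 0.
Proof. by rewrite /enorm dot0l sqrtr0. Qed.

Lemma enormN x : enorm (- x) = enorm x.
Proof. by rewrite /enorm dotNl dotNr opprK. Qed.

Lemma enorm_gt0 x : x != 0 -> 0 < enorm x.
Proof. by rewrite -normr_gt0 => /lt_le_trans -> //; exact: norm_le_enorm. Qed.

(** The limsup is an infimum, over punctured neighborhoods, of suprema, so one of these suprema is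
    below [e]. At [y = x] both sides vanish, which fills the puncture. *)
Lemma superdiff_near (v : 'rV[R]_n -> R) x p (e : R) :
  superdiff v x p -> 0 < e ->
  \forall y \near x, v y - v x - dot p (y - x) <= e * enorm (y - x).
Proof.
move=> vp e0.
have /ereal_inf_lt[_ [W /= xW <-] We] :
    (limf_esup (fun y => (diff_quot v x p y)%:E) x^' < e%:E)%E.
  by rewrite (le_lt_trans vp)// lte_fin.
have : \forall y \near x, y != x -> W y by exact: xW.
apply: filterS => y; have [->|yx /(_ isT) Wy] := eqVneq y x.
  by rewrite !subrr dot0r enorm0 mulr0 subrr.
have y0 : 0 < enorm (y - x) by rewrite enorm_gt0// subr_eq0.
rewrite -ler_pdivrMr// -lee_fin (le_trans _ (ltW We))//.
by apply: ereal_sup_ubound; exists y.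
Qed.

Lemma near_superdiff (v : 'rV[R]_n -> R) x p :
  (forall e : R, 0 < e ->
    \forall y \near x, v y - v x - dot p (y - x) <= e * enorm (y - x)) ->
  superdiff v x p.
Proof.
move=> vp; apply/lee_addgt0Pr => e e0; rewrite add0e.
pose W := [set y | y != x /\ v y - v x - dot p (y - x) <= e * enorm (y - x)].
apply: (@le_trans _ _ (ereal_sup ((fun y => (diff_quot v x p y)%:E) @` W))).
  apply: ereal_inf_lbound; exists W => //.
  suff : \forall y \near x, y != x -> W y by [].
  exact: filterS (vp e e0).
apply: ge_ereal_sup => _ [y [yx yv] <-].
by rewrite lee_fin ler_pdivrMr// enorm_gt0// subr_eq0.
Qed.

Lemma superdiff_linear_perturb (u v : 'rV[R]_n -> R) c x p :
  (forall y, v y = dot c y + u y) ->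
  superdiff v x p -> superdiff u x (p - c).
Proof.
move=> vE vp; apply: near_superdiff => e e0.
apply: filterS (superdiff_near vp e0) => y; apply: le_trans.
by rewrite le_eqVlt; apply/orP; left; apply/eqP; rewrite !vE dotBl !dotBr; ring.
Qed.

End Dot.

(** * Monotonicity from almost everywhere left derivatives *)

Section LeftLowerMonotone.
Context {R : realType}.
Implicit Types (f g : R -> R) (a b s t : R).

(* Continuous induction from b downwards. *)
Lemma le_of_left_increasing g a b : a <= b ->
  (forall s, a <= s < b -> (forall t, s < t <= b -> g t <= g b) -> g s <= g b) ->
  (forall s, a < s <= b ->
    exists2 d : R, 0 < d & forall h, 0 < h < d -> g (s - h) <= g s) ->
  g a <= g b.
Proof.
move=> ab rcont left.
(* [S] collects the points to the right of which the bound holds; its infimum [m] is shown to be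
   [a]. *)
pose S := [set s | a <= s <= b /\ forall t, s < t <= b -> g t <= g b].
have Sb : S b by split=> [|t /andP[/lt_le_trans h /h]]; rewrite ?ltxx// ab lexx.
have Slb : lbound S a by move=> s [/andP[]].
have infS : has_inf S by split; [exists b|exists a].
set m := inf S.
have am : a <= m by apply: lb_le_inf => //; exists b.
have mb : m <= b by apply: ge_inf => //; exists a.
have mS t : m < t <= b -> g t <= g b.
  move=> /andP[mt tb].
  have [s [_ Ss] st] := inf_lt infS.1 mt.
  by apply: Ss; rewrite st.
have gm : g m <= g b.
  by have [->//|] := eqVneq m b; move=> mb'; apply: rcont => //; rewrite am lt_neqAle mb'.
have [<-//|ma] := eqVneq m a.
have {ma} am' : a < m by rewrite lt_neqAle eq_sym ma.
have [d d0 gd] := left m (introT andP (conj am' mb)).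
(* If [a < m], then [left] at [m] extends the bound below [m] and puts this smaller point in [S]. *)
suff : m <= Num.max a (m - d / 2).
  by rewrite leNgt gt_max am' ltrBlDr ltrDl divr_gt0.
apply: ge_inf; first by exists a.
split; first by rewrite le_max lexx/= ge_max ab lerBlDr (le_trans mb)// lerDl divr_ge0// ltW.
move=> t /andP[]; rewrite gt_max => /andP[at_ mt] tb.
have [tm|tm|->//] := ltgtP t m; last by apply: mS; rewrite tm.
rewrite (le_trans _ gm)//.
have := gd (m - t); rewrite subKr; apply.
by rewrite subr_gt0 tm/= ltrBlDr -ltrBlDl (lt_trans _ mt)// ltrD2l ltrN2; lra.
Qed.

Local Notation mu := (@lebesgue_measure R).

(** Take for [m t] the measure of the part of [U] up to [t]. Around a point [t] of [U], the interval
    []t - h, t]] lies in [U] for small [h] and contributes exactly [h]. *)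
Lemma cumulative_measure (U : set R) : open U -> (mu U < +oo)%E ->
  exists m : R -> R, [/\ forall t, 0 <= m t <= fine (mu U),
    {homo m : s t / s <= t} &
    forall t, U t -> exists2 d : R, 0 < d & forall h, 0 < h < d ->
      m t - m (t - h) = h].
Proof.
move=> oU Uoo.
have le_mu (A B : set R) : measurable A -> measurable B -> A `<=` B ->
    (mu A <= mu B)%E.
  by move=> mA mB AB; rewrite le_measure ?inE.
have mU : measurable U by exact: open_measurable.
have mUt t : measurable (U `&` `]-oo, t]) by exact: measurableI.
have fU t : mu (U `&` `]-oo, t]) \is a fin_num.
  by rewrite ge0_fin_numE// (le_lt_trans _ Uoo)// (le_mu _ _ (mUt t) mU)//; exact: subIsetl.
exists (fun t => fine (mu (U `&` `]-oo, t]))); split.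
- move=> t; rewrite fine_ge0//= fine_le//; last by rewrite (le_mu _ _ (mUt t) mU)//; exact: subIsetl.
  by rewrite ge0_fin_numE.
- move=> s t st; rewrite fine_le// (le_mu _ _ (mUt s) (mUt t))//.
  by apply: setIS => r /=; rewrite !in_itv/= => /le_trans; exact.
- move=> t Ut; have /nbhs_ballP[d /= d0 dU] : nbhs t U by exact: open_nbhs_nbhs.
  exists d => // h /andP[h0 hd].
  have -> : U `&` `]-oo, t] = (U `&` `]-oo, (t - h)]) `|` `](t - h), t].
    apply/seteqP; split=> [r /=|r /=].
      rewrite !in_itv/= => -[Ur rt]; case: (leP r (t - h)) => rth; [left|right] => //.
    rewrite !in_itv/= => -[[Ur rt]|/andP[rt rt']].
      by split=> //; rewrite (le_trans rt)// lerBlDr lerDl ltW.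
    split=> //; apply: dU; rewrite /ball/= ltr_norml; lra.
  rewrite measureU//; [|exact: mUt|]; last first.
    apply/seteqP; split=> r //=; rewrite !in_itv/= => -[[_ h1] /andP[h2 _]].
    by move: (le_lt_trans h1 h2); rewrite ltxx.
  have mh : mu `](t - h), t]%classic = h%:E.
    by rewrite lebesgue_measure_itv/= lte_fin ltrBlDr ltrDl h0 -EFinD subKr.
  by rewrite [X in fine (_ + X)%E]mh fineD//= addrAC subrr add0r.
Qed.

(* A null set E is covered by a small open set U on which the function
   m t = mu (U `&` ]-oo, t]) has slope 1: adding 2L * m to f compensates for
   the absence of information on the derivative at points of E. *)
Lemma lipschitz_ae_left_nondecreasing f a b (L : R) (E : set R) : a <= b ->
  (forall s t, a <= s <= b -> a <= t <= b -> `|f s - f t| <= L * `|s - t|) ->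
  mu.-negligible E ->
  (forall s, a < s < b -> ~ E s -> forall e : R, 0 < e ->
    exists2 d : R, 0 < d &
      forall h, 0 < h < d -> a <= s - h -> f (s - h) <= f s + e * h) ->
  f a <= f b.
Proof.
move=> ab fL [N [mN N0 EN]] fE.
have {}fL s t : a <= s <= b -> a <= t <= b ->
    `|f s - f t| <= (Num.max L 0) * `|s - t|.
  by move=> sab tab; rewrite (le_trans (fL _ _ sab tab))// ler_wpM2r// le_max lexx.
have : 0 <= Num.max L 0 by rewrite le_max lexx orbT.
move: fL; set K := Num.max L 0 => fL K0.
(* The error is [e * (b - a)] from the tilt [e * t], plus [2 * K * e] from the cover [U], whose
   measure is below [e]. *)
suff main e : 0 < e -> f a <= f b + e * (b - a + 2 * K).
  apply/ler_addgt0Pr => e e0.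
  have c0 : 0 < b - a + 2 * K + 1 by lra.
  have := main (e / (b - a + 2 * K + 1)) (divr_gt0 e0 c0).
  move=> /le_trans; apply; rewrite lerD2l -mulrA ger_pMr// mulrC.
  by rewrite ler_pdivrMr// mul1r; lra.
move=> e0.
(* Adding [b] to the null set puts it in [U]: the derivative hypothesis covers only [s < b]. *)
pose N' := N `|` [set b].
have N'0 : mu N' = 0.
  by rewrite measureU0//; exact: lebesgue_measure_set1.
have mN' : measurable N' by exact: measurableU.
have [|U [oU NU Ue]] := @lebesgue_regularity_outer R N' e mN' _ e0.
  by rewrite [X in (X < _)%E]N'0.
have {}Ue : (mu U < e%:E)%E.
  rewrite -(setDKU NU) (le_lt_trans (measureU2 _ _ _))//.
    by apply: measurableD => //; exact: open_measurable.
  by rewrite [X in (_ + X)%E]N'0 adde0.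
have Uoo : (mu U < +oo)%E by rewrite (lt_trans Ue)// ltry.
have [m [mU m_le mslope]] := cumulative_measure oU Uoo.
pose g t := f t + e * t + 2 * K * m t.
have : g a <= g b.
  apply: le_of_left_increasing => //.
  - move=> s /andP[as_ sb] gt; apply/ler_addgt0Pr => r r0.
    have K1 : 0 < K + 1 by lra.
    (* This [h] keeps [s + h] within [b] and the possible drop [K * h] of [f] within [r]; the other
       two terms of [g] are nondecreasing. *)
    pose h := Num.min (b - s) (r / (K + 1)).
    have h0 : 0 < h by rewrite lt_min subr_gt0 sb divr_gt0.
    have hb : s + h <= b by rewrite -lerBrDl ge_min lexx.
    have sh : s < s + h <= b by rewrite ltrDl h0.
    have := gt _ sh; rewrite -(lerD2r r) => /(le_trans _); apply.
    have /ler_normlP[_ f1] : `|f s - f (s + h)| <= K * h.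
      rewrite (le_trans (fL _ _ _ _))//; [lra|lra|].
      by rewrite opprD addNKr normrN gtr0_norm.
    have hr : K * h <= r.
      apply: (@le_trans _ _ ((K + 1) * h)); first by rewrite ler_wpM2r ?lerDl// ltW.
      by rewrite mulrC -ler_pdivlMr// ge_min lexx orbT.
    have mm : m s <= m (s + h) by apply: m_le; lra.
    have : 2 * K * m s <= 2 * K * m (s + h) by rewrite ler_wpM2l// mulr_ge0.
    have : e * s <= e * (s + h) by rewrite ler_wpM2l; lra.
    by rewrite /g; lra.
  - move=> s /andP[as_ sb].
    (* On [U] the gain [2 * K * h] of the third term of [g] outweighs the variation [K * h] of [f].
       Off [U] the loss [e * h] allowed to [f] is repaid by the term [e * t]. *)
    have [Us|nUs] := pselect (U s).
      have [d d0 md] := mslope s Us.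
      exists (Num.min d (s - a)); first by rewrite lt_min d0 subr_gt0.
      move=> h /andP[h0]; rewrite lt_min => /andP[hd hs].
      have mh : m s = m (s - h) + h.
        by rewrite -[X in _ + X](md h) ?h0//; ring.
      have /ler_normlP[_ f1] : `|f (s - h) - f s| <= K * h.
        rewrite (le_trans (fL _ _ _ _))//; [lra|lra|].
        by rewrite [s - h]addrC addrK normrN gtr0_norm.
      have : 0 <= K * h by rewrite mulr_ge0// ltW.
      have : 0 <= e * h by rewrite mulr_ge0// ltW.
      by rewrite /g mh; lra.
    have sb' : s < b.
      by rewrite lt_neqAle sb andbT; apply/eqP => sbE; apply: nUs; apply: NU; right.
    have [||d d0 fd] := fE s _ _ e e0; first by rewrite as_.
      by move=> /EN Ns; apply: nUs; apply: NU; left.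
    exists (Num.min d (s - a)); first by rewrite lt_min d0 subr_gt0.
    move=> h /andP[h0]; rewrite lt_min => /andP[hd hs].
    have := fd h; rewrite h0 hd => /(_ isT) fh.
    have mm : m (s - h) <= m s by apply: m_le; lra.
    have : 2 * K * m (s - h) <= 2 * K * m s by rewrite ler_wpM2l// mulr_ge0.
    have : f (s - h) <= f s + e * h by apply: fh; lra.
    by rewrite /g; lra.
rewrite /g => gab.
have Ufe : fine (mu U) <= e.
  by rewrite -lee_fin fineK ?ltW// ge0_fin_numE.
have /andP[ma _] := mU a; have /andP[_ mb] := mU b.
have : 0 <= 2 * K * m a by rewrite !mulr_ge0.
have : 2 * K * m b <= 2 * K * e.
  by rewrite ler_wpM2l ?mulr_ge0// (le_trans mb).
by move: gab; lra.
Qed.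

End LeftLowerMonotone.

(** * Functions of class C1 *)

Section ClassC1.
Context {R : realType} {n : nat}.
Implicit Types (f : 'rV[R]_n -> R) (x y z e : 'rV[R]_n).

Lemma is_derive_line f z e (t : R) : derivable f (z + t *: e) e ->
  is_derive t (1 : R) (fun s : R => f (z + s *: e)) ('D_e f (z + t *: e)).
Proof.
move=> df.
have E : (fun h : R => h^-1 *: (((fun s : R => f (z + s *: e)) \o shift t) (h *: 1)
      - f (z + t *: e))) =
    (fun h : R => h^-1 *: ((f \o shift (z + t *: e)) (h *: e) - f (z + t *: e))).
  apply/funext => h /=; congr (_ *: (f _ - _)).
  by rewrite scaler1 scalerDl addrCA.
by split; rewrite /derivable /derive E.
Qed.

Lemma line_lipschitz f z e (M a b : R) : (forall x, derivable f x e) -> a <= b ->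
  (forall t, a <= t <= b -> `|'D_e f (z + t *: e)| <= M) ->
  `|f (z + b *: e) - f (z + a *: e)| <= M * (b - a).
Proof.
move=> df ab DM.
have dF t := is_derive_line (df (z + t *: e)).
have [|t] := @MVT_segment R (fun s : R => f (z + s *: e)) _ a b ab (fun t _ => dF t).
  apply: continuous_subspaceT => t; apply: differentiable_continuous.
  by apply/derivable1_diffP; exact: (@ex_derive _ _ _ _ _ _ _ (dF t)).
rewrite in_itv/= => tab ->.
by rewrite normrM (ger0_norm (_ : 0 <= b - a)) ?subr_ge0// ler_wpM2r ?subr_ge0// DM.
Qed.

(** Near [x] all partial derivatives are bounded by [M]. Passing from [x] to [y] one coordinate at a
    time, the mean value theorem bounds each change of [f] by [M] times the distance. *)
Lemma classC1_continuous f : classC1 f -> continuous f.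
Proof.
move=> f1 x.
pose M := \sum_(i < n) (`|'D_(basis_vec R i) f x| + 1).
have M0 : 0 <= M by rewrite sumr_ge0// => i _; rewrite addr_ge0.
have : \forall y \near x, forall i : 'I_n, `|'D_(basis_vec R i) f y| <= M.
  suff : forall i, \forall y \near x, `|'D_(basis_vec R i) f y| <= M.
    by move=> H; exact: (@filter_forall _ _ _ (nbhs x) (nbhs_filter x) H).
  move=> i.
  have [_ /(_ x) /cvgrPdist_lt /(_ 1 ltr01)] := f1 i.
  apply: filterS => y xy; rewrite /M (bigD1 i)//= -[X in X <= _]addr0 lerD//.
    by rewrite -lerBlDl (le_trans _ (ltW xy))// distrC (le_trans (ler_norm _))// ler_dist_dist.
  by rewrite sumr_ge0// => j _; rewrite addr_ge0.
move=> /nbhs_normP[d /= d0 dM].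
(* Induction on [k], for points that differ from [x] only in the first [k] coordinates. *)
have key k : (k <= n)%N -> forall y, `|x - y| < d ->
    (forall j : 'I_n, (k <= j)%N -> y 0 j = x 0 j) ->
    `|f y - f x| <= k%:R * M * `|x - y|.
  elim: k => [_ y _ yx|k IH kn y yd yx].
    suff -> : y = x by rewrite subrr normr0 !mul0r.
    by apply/rowP => j; exact: yx.
  pose i := Ordinal kn; pose h := y 0 i - x 0 i.
  pose z := y - h *: basis_vec R i.
  have zE j : z 0 j = if j == i then x 0 i else y 0 j.
    rewrite !mxE/=; case: eqVneq => [->|]; first by rewrite mulr1 /h subKr.
    by rewrite mulr0 subr0.
  have hxy : `|h| <= `|x - y|.
    by rewrite distrC (le_trans _ (coord_le_norm _ 0 i))// !mxE.
  (* The condition [0 <= t * h] gives [t] the sign of [h], so the segment from [z] to [y] stays in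
     the ball where [M] applies. *)
  have tz t : `|t| <= `|h| -> (0 <= t * h) -> `|x - (z + t *: basis_vec R i)| <= `|x - y|.
    move=> th th0; apply: norm_le_coord => // j.
    rewrite 2![in leLHS]mxE [(z + _) 0 j]mxE zE !mxE/=.
    case: eqVneq => [->|ji].
      by rewrite mulr1 opprD addNKr normrN (le_trans th).
    rewrite mulr0 addr0.
    by rewrite (le_trans _ (coord_le_norm _ 0 j))// !mxE.
  have zd : `|x - z| <= `|x - y|.
    by have := tz 0; rewrite scale0r addr0; apply; rewrite ?normr0 ?mul0r.
  have yE : y = z + h *: basis_vec R i by rewrite subrK.
  have yz : `|f y - f z| <= M * `|h|.
    have Mt t : `|t| <= `|h| -> 0 <= t * h ->
        `|'D_(basis_vec R i) f (z + t *: basis_vec R i)| <= M.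
      by move=> th th0; apply: (dM _ _ i); rewrite /= (le_lt_trans (tz _ th th0)).
    have [h0|h0] := leP 0 h.
      rewrite [leRHS](_ : _ = M * (h - 0)); last by rewrite subr0 ger0_norm.
      have -> : f z = f (z + 0 *: basis_vec R i) by rewrite scale0r addr0.
      rewrite [in f y]yE; apply: line_lipschitz => //; first exact: (f1 i).1.
      by move=> t /andP[t0 th]; apply: Mt; rewrite ?mulr_ge0// !ger0_norm.
    rewrite distrC [leRHS](_ : _ = M * (0 - h)); last by rewrite sub0r ltr0_norm.
    have -> : f z = f (z + 0 *: basis_vec R i) by rewrite scale0r addr0.
    rewrite [in f y]yE; apply: line_lipschitz; [exact: (f1 i).1|exact: ltW|].
    move=> t /andP[ht t0]; apply: Mt; last by rewrite mulr_le0// ltW.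
    by rewrite ler0_norm// ltr0_norm// lerN2.
  rewrite -(subrKA (f z)) (le_trans (ler_normD _ _))// -natr1 !mulrDl addrC lerD//.
    apply: le_trans (IH (ltnW kn) z _ _) _.
    - exact: le_lt_trans yd.
    - move=> j kj; rewrite zE; case: eqVneq => [->//|ji].
      apply: yx; rewrite ltn_neqAle kj andbT eq_sym.
      by apply: contra ji => /eqP ji; apply/eqP/val_inj.
    - by rewrite ler_wpM2l// mulr_ge0.
  by rewrite mul1r (le_trans yz)// ler_wpM2l.
suff main (r : R) : 0 < r -> \forall y \near x, `|f x - f y| <= r.
  exact/(@cvgrPdist_le _ _ _ (nbhs x) (nbhs_filter x)).
move=> r0.
have nM : 0 < n%:R * M + 1 by rewrite ltr_wpDl// mulr_ge0.
apply/nbhs_normP; exists (Num.min d (r / (n%:R * M + 1))).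
  by rewrite /= lt_min d0 divr_gt0.
move=> y /=; rewrite lt_min => /andP[yd yr].
rewrite distrC (le_trans (key n (leqnn _) y yd _))//.
  by move=> j; rewrite leqNgt ltn_ord.
apply: (@le_trans _ _ ((n%:R * M + 1) * `|x - y|)).
  by rewrite ler_wpM2r// lerDl.
by rewrite mulrC -ler_pdivlMr// ltW.
Qed.

End ClassC1.

(** * Periodicity, ellipticity, Lipschitz regularity *)

Section Continuity.
Context {R : realType}.

Lemma continuous_sum (T : topologicalType) (I : finType) (F : I -> T -> R) :
  (forall i, continuous (F i)) -> continuous (fun x => \sum_i F i x).
Proof.
by move=> cF; apply: continuous_big => [|i _]; [exact: add_continuous|exact: cF].
Qed.

Lemma continuous_enorm (n : nat) (x : 'rV[R]_n) :
  continuous (fun z : 'rV[R]_n => enorm (z - x)).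
Proof.
have c : continuous (fun z : 'rV[R]_n => dot (z - x) (z - x)).
  apply: continuous_sum => i.
  have ci : continuous (fun z : 'rV[R]_n => (z - x) 0 i).
    have -> : (fun z : 'rV[R]_n => (z - x) 0 i) = (fun z => z 0 i - x 0 i).
      by apply/funext => z; rewrite !mxE.
    move=> z; apply: (@cvgB _ _ _ (nbhs z)); last exact: cvg_cst.
    exact: coord_continuous.
  by move=> z; apply: (@cvgM _ _ (nbhs z)); exact: ci.
by move=> z; exact: (continuous_comp (c z) (@sqrt_continuous R _)).
Qed.

Lemma compact_norm_ball (n : nat) (x : 'rV[R]_n) (r : R) :
  compact [set y | `|y - x| <= r].
Proof.
apply: bounded_closed_compact.
  exists (`|x| + r); split; first exact: num_real.
  move=> M /ltW xrM y /= yr; apply: le_trans xrM.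
  by rewrite -[y](subrKC x) (le_trans (ler_normD _ _))// lerD2l.
have -> : [set y | `|y - x| <= r] = (fun y => `|y - x|) @^-1` [set t | t <= r] by [].
have cn : continuous (fun y : 'rV[R]_n => `|y - x|); last first.
  by apply: preimage_closed => [y _|]; [exact: cn|exact: closed_le].
by move=> y; apply: (@cvg_norm _ _ _ (nbhs y)); apply: cvgB; [exact: cvg_id|exact: cvg_cst].
Qed.

Lemma compact_attains_min (T : topologicalType) (f : T -> R) (K : set T) :
  compact K -> K !=set0 -> continuous f ->
  exists2 x, K x & forall y, K y -> f x <= f y.
Proof.
move=> cK K0 cf.
have [x xK fx] := compact_EVT_min K0 cK (continuous_subspaceT cf).
by exists x; [exact: set_mem|move=> y Ky; apply: fx; exact: mem_set].
Qed.

Lemma compact_attains_max (T : topologicalType) (f : T -> R) (K : set T) :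
  compact K -> K !=set0 -> continuous f ->
  exists2 x, K x & forall y, K y -> f y <= f x.
Proof.
move=> cK K0 cf.
have [x xK fx] := compact_EVT_max K0 cK (continuous_subspaceT cf).
by exists x; [exact: set_mem|move=> y Ky; apply: fx; exact: mem_set].
Qed.

End Continuity.

Section Periodic.
Context {R : realType} {n : nat}.
Implicit Types (x p q : 'rV[R]_n) (A : 'rV[R]_n -> 'M[R]_n).

Lemma periodic_representative (x : 'rV[R]_n) :
  exists k : 'rV[int]_n, `|x + map_mx intr k| <= 1.
Proof.
exists (\row_i - Num.floor (x 0 i)); apply: norm_le_coord => // i.
rewrite !mxE rmorphN/=.
have /andP[] := floor_itv (x 0 i); rewrite intrD1 => h1 h2.
by rewrite ger0_norm ?subr_ge0// lerBlDr addrC ltW.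
Qed.

Lemma periodic_bounded (f : 'rV[R]_n -> R) : Zn_periodic f -> continuous f ->
  exists2 B, 0 <= B & forall x, `|f x| <= B.
Proof.
move=> pf cf.
have [||m _ fm] := compact_attains_max (@compact_norm_ball R n 0 1) _
    (_ : continuous (fun x => `|f x|)).
- by exists 0 => /=; rewrite subrr normr0.
- by move=> x; apply: (@cvg_norm _ _ _ (nbhs x)); exact: cf.
exists `|f m| => // x; have [k xk] := periodic_representative x.
by rewrite -(pf x k); apply: fm; rewrite /= subr0.
Qed.

Lemma quadratic_formE (M : 'M[R]_n) p :
  dot (mxapp M p) p = \sum_i \sum_j M i j * p 0 j * p 0 i.
Proof.
apply: eq_bigr => i _; rewrite !mxE mulr_suml.
by apply: eq_bigr => j _; rewrite mxE.
Qed.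

Lemma mxappZ (M : 'M[R]_n) a p : mxapp M (a *: p) = a *: mxapp M p.
Proof. by rewrite /mxapp linearZ/= -scalemxAr linearZ. Qed.

Lemma mxapp0 (M : 'M[R]_n) : mxapp M 0 = 0.
Proof. by have := mxappZ M 0 0; rewrite !scale0r. Qed.

(** On unit ball times unit sphere the form has a positive minimum by compactness; periodicity in
    [x] and homogeneity of degree 2 in [p] extend the bound everywhere. *)
Lemma uniformly_elliptic A : Zn_periodic A ->
  (forall i j, continuous (fun x => A x i j)) ->
  (forall x, sym_posdef (A x)) ->
  exists2 l : R, 0 < l & forall x p, l * `|p| ^+ 2 <= dot (mxapp (A x) p) p.
Proof.
move=> pA cA posA.
pose S := [set q : 'rV[R]_n | `|q| = 1].
(* The sphere is empty when [n = 0]; every [p] is then zero. *)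
have [S0|] := pselect (S !=set0); last first.
  move=> S0; exists 1 => // x p; suff -> : p = 0.
    by rewrite normr0 expr0n mulr0 mxapp0 dot0l.
  apply/eqP/negPn/negP => p0; apply: S0; exists (`|p|^-1 *: p).
  by rewrite /S/= normrZ normfV normr_id mulVf// normr_eq0.
have cS : compact S.
  apply: (@subclosed_compact _ _ [set y | `|y - 0| <= 1]); last 2 first.
  - exact: compact_norm_ball.
  - by move=> q; rewrite /S/= subr0 => ->.
  have -> : S = (fun q => `|q|) @^-1` [set 1] by [].
  apply: preimage_closed; last exact: closed_eq.
  by move=> q _; exact: norm_continuous.
pose F (z : 'rV[R]_n * 'rV[R]_n) := dot (mxapp (A z.1) z.2) z.2.
have cF : continuous F.
  rewrite /F; under eq_fun do rewrite quadratic_formE.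
  apply: continuous_sum => i; apply: continuous_sum => j z.
  have c2 k : continuous (fun w : 'rV[R]_n * 'rV[R]_n => w.2 0 k).
    move=> w; apply: (@continuous_comp _ _ _ snd (fun p : 'rV[R]_n => p 0 k)).
      exact: cvg_snd.
    exact: coord_continuous.
  apply: cvgM; last exact: c2.
  apply: cvgM; last exact: c2.
  apply: (@continuous_comp _ _ _ fst (fun x => A x i j)); first exact: cvg_fst.
  exact: cA.
have [|[x0 q0] [_ q01] Fmin] :=
    compact_attains_min (compact_setX (@compact_norm_ball R n 0 1) cS) _ cF.
  by have [q Sq] := S0; exists (0, q); split => //=; rewrite subrr normr0.
exists (F (x0, q0)).
  by apply: (posA x0).2; rewrite -normr_gt0 q01.
move=> x p; have [k xk] := periodic_representative x.
have [->|p0] := eqVneq p 0.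
  by rewrite normr0 expr0n mulr0 mxapp0 dot0l.
have np : 0 < `|p| by rewrite normr_gt0.
have := Fmin (x + map_mx intr k, `|p|^-1 *: p).
rewrite {2}/F/= pA mxappZ dotZl dotZr mulrA -expr2 exprVn mulrC.
rewrite ler_pdivlMr ?exprn_gt0//; apply; split => /=; first by rewrite subr0.
by rewrite /S/= normrZ normfV normr_id mulVf// gt_eqF.
Qed.

Lemma mxapp_bounded A : Zn_periodic A ->
  (forall i j, continuous (fun x => A x i j)) ->
  exists2 M : R, 0 <= M & forall x p, `|mxapp (A x) p| <= M * `|p|.
Proof.
move=> pA cA.
have bA (ij : 'I_n * 'I_n) : exists B, forall x, `|A x ij.1 ij.2| <= B.
  have [|B _ ?] := @periodic_bounded (fun x => A x ij.1 ij.2) _ (cA _ _).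
    by move=> x k; rewrite pA.
  by exists B.
have [B HB] := choice bA.
pose M := \sum_ij `|B ij|.
have AM x i j : `|A x i j| <= M.
  rewrite (le_trans (HB (i, j) x))// (le_trans (ler_norm _))// /M.
  by rewrite (bigD1 (i, j))//= lerDl sumr_ge0.
exists (n%:R * M); first by rewrite mulr_ge0// sumr_ge0.
move=> x p; apply: norm_le_coord; first by rewrite !mulr_ge0// sumr_ge0.
move=> i; rewrite !mxE (le_trans (ler_norm_sum _ _ _))//.
rewrite -[n in n%:R]card_ord -sumr_const !mulr_suml ler_sum// => j _.
by rewrite mul1r normrM ler_pM// mxE coord_le_norm.
Qed.

(** By ellipticity, [l |p| <= l |p|^2 <= 2 (a - V x)] as soon as [|p| > 1], and [V] is bounded by
    periodicity. *)
Lemma hamiltonian_coercive A (V : 'rV[R]_n -> R) (a : R) : Zn_periodic A ->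
  (forall i j, continuous (fun x => A x i j)) ->
  (forall x, sym_posdef (A x)) -> Zn_periodic V -> continuous V ->
  exists2 K : R, 0 <= K & forall x p, hamiltonian A V x p <= a -> `|p| <= K.
Proof.
move=> pA cA posA pV cV.
have [l l0 Al] := uniformly_elliptic pA cA posA.
have [B B0 VB] := periodic_bounded pV cV.
have C0 : 0 <= 2 * (`|a| + B) / l by rewrite divr_ge0 ?mulr_ge0 ?addr_ge0// ltW.
exists (1 + 2 * (`|a| + B) / l); first by rewrite addr_ge0.
move=> x p Ha; have [p1|p1] := leP `|p| 1; first by rewrite (le_trans p1)// lerDl.
apply: (@le_trans _ _ (2 * (`|a| + B) / l)); last by rewrite lerDr.
rewrite ler_pdivlMr// mulrC.
apply: (@le_trans _ _ (l * `|p| ^+ 2)).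
  by rewrite ler_pM2l// expr2 ler_pMr ?ltW// (lt_trans ltr01 p1).
apply: le_trans (Al x p) _.
move: Ha (VB x) (ler_norm a); rewrite /hamiltonian ler_norml => Ha /andP[Vl _] aa.
by lra.
Qed.

(* AM-GM: 2 |p| |p + q| <= |p|^2 + |p + q|^2 *)
Lemma enorm_tangent p q :
  2 * enorm p * enorm (p + q) <= 2 * enorm p ^+ 2 + 2 * dot p q + enorm q ^+ 2.
Proof.
have := sqr_ge0 (enorm (p + q) - enorm p).
rewrite sqrrB !enorm_sqr dotDl !dotDr (dotC q p) -mulr_natl.
by lra.
Qed.

(** Comparison with a cone: [u] minus the cone of slope [C] with vertex [x] attains a maximum. Away
    from [x], the gradient of the cone at that maximum would be a superdifferential of [u] of
    Euclidean norm [C], whereas such norms are at most [n K < C]. So the maximum is at [x]. *)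
Lemma superdiff_bounded_lipschitz (u : 'rV[R]_n -> R) (K : R) : Zn_periodic u ->
  continuous u -> 0 <= K -> (forall x p, superdiff u x p -> `|p| <= K) ->
  exists2 L : R, 0 <= L & forall x y, `|u x - u y| <= L * `|x - y|.
Proof.
move=> pu cu K0 uK.
have [B B0 uB] := periodic_bounded pu cu.
pose C := n%:R * K + 1.
have C0 : 0 < C by rewrite ltr_wpDl// mulr_ge0.
suff main x y : u y - u x <= C * enorm (y - x).
  have {}main x y : u y - u x <= C * n%:R * `|x - y|.
    by rewrite (le_trans (main x y))// -mulrA distrC ler_wpM2l ?enorm_le_norm// ltW.
  exists (C * n%:R) => [|x y]; first by rewrite mulr_ge0// ltW.
  by rewrite ler_norml lerNl opprB main/= distrC main.
pose phi z := u z - C * enorm (z - x).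
have cphi : continuous phi.
  move=> z; apply: (@cvgB _ _ _ (nbhs z)); first exact: cu.
  apply: (@cvgM _ _ (nbhs z)); first exact: cvg_cst.
  exact: continuous_enorm.
(* Beyond radius [r] the cone exceeds [2 * B], hence the oscillation of [u], so the maximum over
   this ball is global. *)
pose r := 2 * B / C.
have r0 : 0 <= r by rewrite divr_ge0 ?mulr_ge0// ltW.
have [|m _ mball] := compact_attains_max (@compact_norm_ball R n x r) _ cphi.
  by exists x => /=; rewrite subrr normr0.
have phix : phi x = u x by rewrite /phi subrr enorm0 mulr0 subr0.
have mmax z : phi z <= phi m.
  have [zr|zr] := leP `|z - x| r; first exact: mball.
  apply: le_trans _ (mball x _); last by rewrite /= subrr normr0.
  have : 2 * B <= C * enorm (z - x).
    by rewrite [leRHS]mulrC -ler_pdivrMr// -/r (le_trans (ltW zr))// norm_le_enorm.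
  have /andP[_ uz] : - B <= u z <= B by rewrite -ler_norml.
  have /andP[ux _] : - B <= u x <= B by rewrite -ler_norml.
  by rewrite phix /phi; lra.
have [mx|mx] := eqVneq m x.
  by have := mmax y; rewrite mx phix /phi; lra.
exfalso; set b := m - x.
have b0 : b != 0 by rewrite subr_eq0.
have nb : 0 < enorm b by exact: enorm_gt0.
pose p := (C / enorm b) *: b.
suff /uK pK : superdiff u m p.
  have : C <= n%:R * K.
    apply: (@le_trans _ _ (n%:R * `|p|)); last by rewrite ler_wpM2l.
    apply: le_trans _ (enorm_le_norm p).
    rewrite -ler_sqr ?nnegrE ?enorm_ge0 ?(ltW C0)// enorm_sqr dotZl dotZr -enorm_sqr.
    by rewrite mulrA -!expr2 -exprMn divfK ?gt_eqF.
  by rewrite /C; lra.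
apply: near_superdiff => e e0.
have n1 : 0 < n%:R + 1 :> R by rewrite ltr_wpDl.
(* Radius on which the quadratic remainder [C |w|^2 / (2 |b|)] of the cone is at most [e |w|]; the
   factor [n + 1] passes from the sup norm to the Euclidean one and is positive even for [n = 0]. *)
pose d := e * (2 * enorm b) / C / (n%:R + 1).
have d0 : 0 < d by rewrite !divr_gt0// !mulr_gt0.
have : \forall z \near m, `|m - z| < d.
  by apply/nbhs_normP; exists d.
apply: filterS => z zd; set w := z - m.
have zE : z - x = b + w by rewrite /w /b [RHS]addrC subrKA.
have := mmax z; rewrite /phi zE -/b => mz.
have wd : C * enorm w <= e * (2 * enorm b).
  rewrite mulrC -ler_pdivlMr// (le_trans (enorm_le_norm _))//.
  rewrite (@le_trans _ _ ((n%:R + 1) * `|w|))//; first by rewrite ler_wpM2r// lerDl.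
  by rewrite mulrC -ler_pdivlMr// /w distrC ltW.
have amgm := enorm_tangent b w.
have dotE : dot p w = C * (dot b w / enorm b).
  by rewrite dotZl mulrAC mulrA.
have : C * (enorm (b + w) - enorm b) <= C * (dot b w / enorm b) + e * enorm w.
  rewrite -(ler_pM2r (_ : 0 < 2 * enorm b)) ?mulr_gt0//.
  rewrite [leRHS](_ : _ = C * (2 * dot b w) + enorm w * (e * (2 * enorm b)));
    last by field; rewrite gt_eqF.
  apply: (@le_trans _ _ (C * (2 * dot b w) + enorm w * (C * enorm w))); last first.
    by rewrite lerD2l ler_wpM2l// enorm_ge0.
  rewrite [leRHS](_ : _ = C * (2 * dot b w + enorm w ^+ 2)); last by ring.
  rewrite -mulrA ler_pM2l//; lra.
by rewrite dotE; lra.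
Qed.

End Periodic.

(** * Generalized characteristics *)

Section ArcDerivative.
Context {R : realType} {n : nat}.
Implicit Types (g : R -> 'rV[R]_n) (v : 'rV[R]_n -> R) (d p : 'rV[R]_n).
Local Notation mu := (@lebesgue_measure R).

Lemma left_expansion g (s e : R) d : is_derive s 1 g d -> 0 < e ->
  exists2 r : R, 0 < r &
    forall h, 0 < h < r -> `|g (s - h) - g s + h *: d| <= e * h.
Proof.
move=> [dg gd] e0.
have : (fun h : R => h^-1 *: ((g \o shift s) (h *: 1) - g s)) @ 0^' --> d.
  by rewrite -gd; exact: dg.
move=> /cvgrPdist_le /(_ _ e0) [r /= r0 rg].
exists r => // h /andP[h0 hr].
have := rg (- h); rewrite /ball/= sub0r opprK gtr0_norm// oppr_eq0 gt_eqF//.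
move=> /(_ hr isT); rewrite scaler1 (addrC (- h)) => H.
have -> : g (s - h) - g s + h *: d =
    h *: (d - (- h)^-1 *: (g (s - h) - g s)).
  rewrite scalerBr scalerA invrN mulrN mulfV ?gt_eqF// scaleN1r opprK.
  by rewrite addrC.
by rewrite normrZ gtr0_norm// mulrC ler_wpM2r// ltW.
Qed.

(** An upper bound on [v] near [g s], read at the earlier point [g (s - h)], is a lower bound on the
    left derivative of [v] along [g]. *)
Lemma superdiff_left_expansion v g (s e : R) d p : is_derive s 1 g d ->
  superdiff v (g s) p -> 0 < e ->
  exists2 r : R, 0 < r & forall h, 0 < h < r ->
    v (g (s - h)) <= v (g s) - h * dot p d + e * h.
Proof.
move=> gd vp e0.
(* [c] adds up the errors in units of [k * h]: the superdifferential remainder, the deviation [w] of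
   the arc from its tangent paired with [p], and a slack of 1 that makes [c] positive. *)
pose c : R := n%:R * (`|d| + 1) + n%:R * `|p| + 1.
have c0 : 0 < c by rewrite ltr_wpDl// addr_ge0// mulr_ge0// addr_ge0.
have [k k0 kc] : exists2 k : R, 0 < k & k * c = e.
  by exists (e / c); [rewrite divr_gt0|rewrite divfK ?gt_eqF].
have /nbhs_normP[r1 /= r10 vr] := superdiff_near vp k0.
pose e' : R := Num.min (1 : R) k.
have m0 : 0 < e' by rewrite lt_min ltr01.
have e'1 : e' <= 1 by rewrite ge_min lexx.
have e'c : e' <= k by rewrite ge_min lexx orbT.
have [r2 r20 gr] := left_expansion gd m0.
have d1 : 0 < `|d| + 1 by rewrite ltr_wpDl.
exists (Num.min r2 (r1 / (`|d| + 1))); first by rewrite lt_min r20 divr_gt0.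
move=> h /andP[h0]; rewrite lt_min => /andP[hr2].
rewrite ltr_pdivlMr// => hr1.
set y := g (s - h); set w := y - g s + h *: d.
have wh : `|w| <= e' * h by apply: gr; rewrite h0.
have w1 : `|w| <= h.
  by rewrite (le_trans wh)// ger_pMl.
have w2 : `|w| <= k * h.
  by rewrite (le_trans wh)// ler_wpM2r// ltW.
have yE : y - g s = w - h *: d by rewrite /w addrK.
have ynorm : `|y - g s| <= h * (`|d| + 1).
  rewrite yE (le_trans (ler_normB _ _))// normrZ (gtr0_norm h0).
  by rewrite mulrDr mulr1 addrC lerD2l.
have : v y - v (g s) - dot p (y - g s) <= k * enorm (y - g s).
  by apply: vr; rewrite /= distrC (le_lt_trans ynorm).
have en : k * enorm (y - g s) <= k * (n%:R * (`|d| + 1)) * h.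
  rewrite -mulrA ler_wpM2l ?(ltW k0)// (le_trans (enorm_le_norm _))//.
  by rewrite -mulrA ler_wpM2l// mulrC.
have pw : dot p w <= k * (n%:R * `|p|) * h.
  rewrite (le_trans (ler_norm _))// (le_trans (dot_norm _ _))//.
  rewrite [leRHS](_ : _ = n%:R * (`|p| * (k * h))); last by ring.
  by rewrite !ler_wpM2l.
have kh : 0 <= k * h by rewrite mulr_ge0// ltW.
have ch : k * (n%:R * (`|d| + 1)) * h + k * (n%:R * `|p|) * h + k * h = e * h.
  by rewrite -kc /c; ring.
rewrite yE dotBr dotZr in en *; lra.
Qed.

(** For each coordinate and each sign [sg], the function [S * t - sg * g t 0 i] has nonnegative
    derivative almost everywhere, so the monotonicity criterion applies to it. *)
Lemma ae_derivative_bound g (a b G S : R) (E : set R) : a <= b ->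
  (forall s t, a <= s <= b -> a <= t <= b -> `|g s - g t| <= G * `|s - t|) ->
  mu.-negligible E -> 0 <= S ->
  (forall s, a < s < b -> ~ E s -> exists2 d, is_derive s 1 g d & `|d| <= S) ->
  `|g b - g a| <= S * (b - a).
Proof.
move=> ab gG E0 S0 gE.
have key (sg : R) i : `|sg| = 1 -> sg * (g b 0 i - g a 0 i) <= S * (b - a).
  move=> sg1.
  pose f t := S * t - sg * g t 0 i.
  suff : f a <= f b by rewrite /f; lra.
  apply: (@lipschitz_ae_left_nondecreasing _ f a b (S + G) E) => //.
    move=> s t sab tab.
    have -> : f s - f t = S * (s - t) - sg * (g s - g t) 0 i.
      by rewrite !mxE /f; ring.
    rewrite (le_trans (ler_normB _ _))// mulrDl normrM (ger0_norm S0) lerD2l.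
    by rewrite normrM sg1 mul1r (le_trans (coord_le_norm _ _ _))// gG.
  move=> s sab /(gE s sab)[d gd dS] e e0.
  have [r r0 gr] := left_expansion gd e0.
  exists r => // h hr _.
  have /andP[h0 _] := hr.
  have : `|sg * (g (s - h) - g s + h *: d) 0 i| <= e * h.
    by rewrite normrM sg1 mul1r (le_trans (coord_le_norm _ _ _))// gr.
  rewrite ler_norml => /andP[+ _].
  have : `|sg * d 0 i| <= S.
    by rewrite normrM sg1 mul1r (le_trans (coord_le_norm _ _ _)).
  rewrite ler_norml => /andP[_ sd].
  have : h * (sg * d 0 i) <= h * S by rewrite ler_wpM2l// ltW.
  by rewrite !mxE /f; nra.
apply: norm_le_coord; first by rewrite mulr_ge0// subr_ge0.
move=> i; rewrite !mxE ler_norml lerNl.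
by rewrite -{1}mulN1r -[X in _ && (X <= _)]mul1r !key ?normrN ?normr1.
Qed.

End ArcDerivative.

(** * Monotonicity of [v], speed and rest points along characteristics *)

Section Characteristics.
Context {R : realType} {n : nat}.
Variables (A : 'rV[R]_n -> 'M[R]_n) (v : 'rV[R]_n -> R) (L S : R).
Hypothesis A_posdef : forall x, sym_posdef (A x).
Hypothesis v_lipschitz : forall x y, `|v x - v y| <= L * `|x - y|.
Hypothesis speed : forall x p, superdiff v x p -> `|mxapp (A x) p| <= S.
Hypotheses (L0 : 0 <= L) (S0 : 0 <= S).
Implicit Types (g : R -> 'rV[R]_n) (x p : 'rV[R]_n).

Lemma dot_mxapp_ge0 x p : 0 <= dot (mxapp (A x) p) p.
Proof.
have [->|p0] := eqVneq p 0; first by rewrite dot0r.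
by rewrite ltW// (A_posdef x).2.
Qed.

Lemma characteristic_lipschitz x g : gen_characteristic A v x g ->
  exists2 G, 0 <= G & forall s t, 0 <= s -> 0 <= t -> `|g s - g t| <= G * `|s - t|.
Proof.
move=> [_ /pinfty_ex_gt0[G G0 gG] _]; exists G; first exact: ltW.
by move=> s t s0 t0; exact: (gG (s, t)).
Qed.

Lemma characteristic_nondecreasing x g a b : gen_characteristic A v x g ->
  0 <= a -> a <= b -> v (g a) <= v (g b).
Proof.
move=> gx a0 ab; have [G G0 gG] := characteristic_lipschitz gx.
case: gx => _ _ aeg.
apply: (lipschitz_ae_left_nondecreasing (f := v \o g) (L := L * G) ab _ aeg).
  move=> s t /andP[as_ _] /andP[at_ _] /=; rewrite (le_trans (v_lipschitz _ _))//.
  by rewrite -mulrA ler_wpM2l// gG// (le_trans a0).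
move=> s /andP[as_ _] /contrapT/(_ (le_lt_trans a0 as_))[p vp gp] e e0.
have [r r0 H] := superdiff_left_expansion gp vp e0.
exists r => // h hr _ /=; rewrite (le_trans (H h hr))// lerD2r gerDl oppr_le0.
by move/andP: hr => [h0 _]; rewrite mulr_ge0 ?(ltW h0)// dotC dot_mxapp_ge0.
Qed.

(** Unlike the Lipschitz constant [G] of an individual arc, [S] is uniform over starting points;
    this keeps [Phi 1] within bounded distance of the identity. *)
Lemma characteristic_speed x g a b : gen_characteristic A v x g ->
  0 <= a -> a <= b -> `|g b - g a| <= S * (b - a).
Proof.
move=> gx a0 ab; have [G G0 gG] := characteristic_lipschitz gx.
case: gx => _ _ aeg; apply: (ae_derivative_bound ab _ aeg S0).
  by move=> s t /andP[as_ _] /andP[at_ _]; apply: gG; rewrite (le_trans a0).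
move=> s /andP[as_ _] /contrapT/(_ (le_lt_trans a0 as_))[p vp gp].
by exists (mxapp (A (g s)) p) => //; exact: speed.
Qed.

(* If v is constant along the arc, its derivative <A p, p> vanishes almost
   everywhere, so p = 0: the arc does not move and 0 is a superdifferential. *)
Lemma characteristic_stationary x g b : gen_characteristic A v x g ->
  0 < b -> v (g b) = v (g 0) -> Crit v x.
Proof.
move=> gx b0 vb; have [G G0 gG] := characteristic_lipschitz gx.
have vg t : 0 <= t <= b -> v (g t) = v (g 0).
  move=> /andP[t0 tb]; apply/eqP.
  by rewrite eq_le -{1}vb !(characteristic_nondecreasing gx).
have [g0 _ aeg] := gx.
(* If [p] were nonzero, the expansion with error [q / 2] would make [v] strictly smaller just before
   [s], against its constancy. *)
have good s : 0 < s < b -> (0 < s ->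
    exists2 p, superdiff v (g s) p & is_derive s 1 g (mxapp (A (g s)) p)) ->
    superdiff v (g s) 0 /\ is_derive s 1 g 0.
  move=> /andP[s0 sb] /(_ s0)[p vp gp].
  suff p0 : p = 0 by split; [|rewrite -(mxapp0 (A (g s)))]; rewrite -p0.
  apply/eqP/negPn/negP => p0; have := (A_posdef (g s)).2 p p0.
  rewrite dotC; set q := dot _ _ => q0.
  have [r r0 H] := superdiff_left_expansion gp vp (divr_gt0 q0 (ltr0n _ 2)).
  pose h := Num.min (r / 2) s.
  have h0 : 0 < h by rewrite lt_min s0 divr_gt0.
  have hr : h < r by rewrite /h gt_min ltr_pdivrMr// ltr_pMr// ltr1n.
  have hs : h <= s by rewrite ge_min lexx orbT.
  have := H h; rewrite h0 hr => /(_ isT).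
  rewrite !vg; [|lra|lra].
  have : 0 < h * q by rewrite mulr_gt0.
  by rewrite -/q; lra.
have gconst t : 0 <= t <= b -> g t = x.
  move=> /andP[t0 tb]; rewrite -g0; apply/eqP; rewrite -subr_eq0 -normr_le0.
  suff : `|g t - g 0| <= 0 * (t - 0) by rewrite mul0r.
  apply: (ae_derivative_bound t0 _ aeg) => //.
    by move=> s s' /andP[ss _] /andP[ss' _]; exact: gG.
  move=> s /andP[ss st] /contrapT Es; exists 0; last by rewrite normr0.
  by apply: (good s _ Es).2; rewrite ss (lt_le_trans st).
apply: contrapT => nx.
(* A good time exists in []0, b[]: otherwise the derivative hypothesis of the monotonicity criterion
   holds vacuously there, even for the decreasing function [-%R]. *)
suff : - 0 <= - b by rewrite lerN2 leNgt b0.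
apply: (lipschitz_ae_left_nondecreasing (f := -%R) (L := 1) (ltW b0) _ aeg).
  by move=> s t _ _; rewrite -opprD normrN mul1r.
move=> s sb /contrapT Es; exfalso; apply: nx.
have := (good s sb Es).1; rewrite gconst//.
by move/andP: sb => [s0 sb]; rewrite !ltW.
Qed.

(** At a critical point the choice [p = 0] is admissible; uniqueness of characteristics then makes
    the point fixed by the flow. *)
Lemma crit_constant_characteristic x : Crit v x ->
  gen_characteristic A v x (fun=> x).
Proof.
move=> vx; split => //.
  exists 0; split => // M M0 [s t] _ /=.
  by rewrite subrr normr0 mulr_ge0// ltW.
apply: aeW => s _; exists 0 => //; rewrite mxapp0; exact: is_derive_cst.
Qed.

End Characteristics.

(** * Recurrence *)

Section Recurrence.
Context {R : realType} {n : nat}.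
Implicit Types (Phi : R -> 'rV[R]_n -> 'rV[R]_n) (x y z : 'rV[R]_n).

Lemma semiflow_continuous Phi (t : R) : semiflow Phi -> 0 <= t ->
  continuous (Phi t).
Proof.
move=> [_ _ /subspace_continuousP cPhi] t0 x.
have := cPhi (t, x) t0; apply: cvg_trans => U /= [[B1 B2] [/= tB1 xB2] BU].
apply: filterS xB2 => y By.
by apply: (BU (t, y)) => //; split => //; exact: nbhs_singleton.
Qed.

(** An orbit with a limit point in the interior of [U] visits [U] at some [t1] and again at some
    [t2 >= t1 + T], so [Phi (t2 - t1)] returns a point of [U] to [U]. *)
Lemma limit_set_nonwandering Phi : semiflow Phi ->
  limit_set Phi `<=` nonwandering Phi.
Proof.
move=> [_ PhiD _] x Lx U T /nbhs_interior xU T0.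
have [w [[y _ wy] Uw]] := Lx _ xU.
have wU : nbhs w U by exact: Uw.
have [_ [[t1 /= t10 <-] U1]] := wy 0 (lexx 0) U wU.
have t1T : 0 <= t1 + T by rewrite addr_ge0// ltW.
have [_ [[t2 /= t12 <-] U2]] := wy (t1 + T) t1T U wU.
exists (t2 - t1); first by rewrite lerBrDl.
exists (Phi t2 y); split => //; exists (Phi t1 y) => //.
by rewrite -PhiD ?subrK// subr_ge0 (le_trans _ t12)// lerDl ltW.
Qed.

(** Two jumps suffice: from [x] flow for [T] and jump to [Phi T y], then flow for [t - T] to
    [Phi t y], close to [x], and jump to [x]. Asking for [t >= 2 * T] makes both flow times at least
    [T]. *)
Lemma nonwandering_chain_recurrent Phi : semiflow Phi ->
  nonwandering Phi `<=` chain_recurrent Phi.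
Proof.
move=> sPhi x xNW eps T ceps eps0 T0; have [_ PhiD _] := sPhi.
have T2 : 0 < 2 * T by rewrite mulr_gt0.
have U1 : \forall y \near x, enorm (Phi T x - Phi T y) < eps (Phi T x).
  have c1 : continuous (fun y => enorm (Phi T y - Phi T x)).
    have cT : continuous (Phi T) by apply: semiflow_continuous => //; exact: ltW.
    by move=> y; exact: (continuous_comp (cT y) (@continuous_enorm _ _ _ (Phi T y))).
  have := (@cvgr_lt _ _ (nbhs x) (nbhs_filter x) _ _ (c1 x) (eps (Phi T x))).
  rewrite subrr enorm0 => /(_ (eps0 _)).
  by apply: filterS => y; rewrite -opprB enormN.
(* The last jump is measured by [eps] at the point it leaves, hence [eps y] and not [eps x]. *)
have U2 : \forall y \near x, enorm (y - x) < eps y.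
  have c2 : continuous (fun y => enorm (y - x) - eps y).
    move=> y; apply: (@cvgB _ _ _ (nbhs y)); last exact: ceps.
    exact: continuous_enorm.
  have := (@cvgr_lt _ _ (nbhs x) (nbhs_filter x) _ _ (c2 x) 0).
  rewrite subrr enorm0 sub0r oppr_lt0 => /(_ (eps0 _)).
  by apply: filterS => y; rewrite subr_lt0.
have [t tT [_ [[y [Uy1 Uy2] <-] [Ut1 Ut2]]]] := xNW _ _ (filterI U1 U2) T2.
exists 2%N => //.
exists (fun j => if j is 1%N then Phi T y else x), (fun j => if j is 0%N then T else t - T).
split => // -[_|[_|//]] /=; first by [].
have tT' : T <= t - T by lra.
split => //; rewrite -PhiD ?subrK// ?ltW//.
by rewrite (lt_le_trans T0).
Qed.

(** Displacement at most [S] confines the relevant [y] to the part of [N] within [1 + S] of [z],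
    which is compact, so a positive minimum is attained. *)
Lemma nbhs_lower_bound_min (F : 'rV[R]_n -> 'rV[R]_n) (f : 'rV[R]_n -> R)
    (N : set 'rV[R]_n) (S : R) z : continuous F -> continuous f -> closed N ->
  (forall y, `|F y - y| <= S) -> (forall y, N y -> 0 < f (F y)) ->
  exists2 d : R, 0 < d & forall y, N y -> `|z - F y| <= 1 -> d <= f (F y).
Proof.
move=> cF cf clN FS f0.
pose K := N `&` [set y | `|y - z| <= 1 + S].
have cK : compact K.
  apply: (@subclosed_compact _ _ [set y | `|y - z| <= 1 + S]).
  - apply: closedI => //; apply: compact_closed; first exact: norm_hausdorff.
    exact: compact_norm_ball.
  - exact: compact_norm_ball.
  - exact: subIsetr.
have KN y : N y -> `|z - F y| <= 1 -> K y.
  move=> Ny zF; split => //=; rewrite distrC -(subrKA (F y)).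
  by rewrite (le_trans (ler_normD _ _))// lerD.
have [K0|K0] := pselect (K !=set0); last first.
  by exists 1 => // y Ny /(KN _ Ny) Ky; exfalso; apply: K0; exists y.
have cfF : continuous (f \o F).
  by move=> y; apply: continuous_comp; [exact: cF|exact: cf].
have [y0 [Ny0 _] fy0] := compact_attains_min cK K0 cfF.
by exists (f (F y0)); [exact: f0|move=> y Ny /(KN _ Ny) /fy0].
Qed.

(* The inf-convolution of f with the distance, restricted to the points of
   F @` N: a positive 1-Lipschitz minorant of f on F @` N. *)
Lemma positive_continuous_minorant (F : 'rV[R]_n -> 'rV[R]_n)
    (f : 'rV[R]_n -> R) (N : set 'rV[R]_n) (S : R) :
  continuous F -> continuous f -> closed N ->
  (forall y, `|F y - y| <= S) -> (forall y, N y -> 0 < f (F y)) ->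
  exists eps : 'rV[R]_n -> R, [/\ continuous eps, forall z, 0 < eps z
    & forall y, N y -> eps (F y) <= f (F y)].
Proof.
move=> cF cf clN FS f0.
have [N0|N0] := pselect (N !=set0); last first.
  exists (fun=> 1); split => // [|y Ny]; first by move=> z; exact: (@cvg_cst _ _ _ (nbhs z)).
  by exfalso; apply: N0; exists y.
pose E z := [set f (F y) + `|z - F y| | y in N].
have E0 z : E z !=set0 by have [y Ny] := N0; exists (f (F y) + `|z - F y|), y.
have Elb z : lbound (E z) 0 by move=> _ [y Ny <-]; rewrite addr_ge0// ltW// f0.
have Ei z y : N y -> inf (E z) <= f (F y) + `|z - F y|.
  by move=> Ny; apply: ge_inf; [exists 0; exact: Elb|exists y].
have lip z w : inf (E z) <= inf (E w) + `|z - w|.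
  rewrite -lerBlDr; apply: lb_le_inf => // _ [y Ny <-].
  rewrite lerBlDr (le_trans (Ei z y Ny))// -addrA lerD2l addrC.
  by rewrite (le_trans _ (ler_normD _ _))// subrKA.
exists (fun z => inf (E z)); split.
- move=> z.
  suff main (r : R) : 0 < r -> \forall w \near z, `|inf (E z) - inf (E w)| <= r.
    exact/(@cvgrPdist_le _ _ _ (nbhs z) (nbhs_filter z)).
  move=> r0; apply/nbhs_normP; exists r => //= w zw.
  rewrite (le_trans _ (ltW zw))// ler_norml lerNl opprB.
  have zw1 := lip z w; have := lip w z; rewrite distrC => zw2.
  by apply/andP; split; rewrite lerBlDl.
- move=> z; have [d d0 dN] := nbhs_lower_bound_min z cF cf clN FS f0.
  (* Points [F y] within distance 1 of [z] contribute at least [d], the others more than 1 through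
     the distance. *)
  apply: (@lt_le_trans _ _ (Num.min d 1)); first by rewrite lt_min d0 ltr01.
  apply: lb_le_inf => // _ [y Ny <-].
  have [zy|zy] := leP `|z - F y| 1; rewrite ge_min.
    by rewrite (le_trans (dN y Ny zy))// lerDl.
  by rewrite (_ : 1 <= _) ?orbT// (le_trans (ltW zy))// lerDr ltW// f0.
- by move=> y Ny; have := Ei (F y) y Ny; rewrite subrr normr0 addr0.
Qed.

(** * The flow with [v] as Lyapunov function *)

Section LyapunovFlow.
Variables (A : 'rV[R]_n -> 'M[R]_n) (v : 'rV[R]_n -> R) (L S : R).
Variable Phi : R -> 'rV[R]_n -> 'rV[R]_n.
Hypothesis A_posdef : forall x, sym_posdef (A x).
Hypothesis v_lipschitz : forall x y, `|v x - v y| <= L * `|x - y|.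
Hypothesis speed : forall x p, superdiff v x p -> `|mxapp (A x) p| <= S.
Hypotheses (L0 : 0 <= L) (S0 : 0 <= S).
Hypothesis Phi_semiflow : characteristic_semiflow A v Phi.

Let Phi_char x : gen_characteristic A v x (fun t => Phi t x).
Proof. exact: (Phi_semiflow.2 x).1. Qed.

Lemma flow_nondecreasing x s t : 0 <= s -> s <= t -> v (Phi s x) <= v (Phi t x).
Proof. exact: (characteristic_nondecreasing A_posdef v_lipschitz L0 (Phi_char x)). Qed.

Lemma flow_increasing x t : 0 < t -> ~ Crit v x -> v x < v (Phi t x).
Proof.
move=> t0 nx; have P0 : Phi 0 x = x by case: Phi_semiflow => -[].
rewrite lt_neqAle; apply/andP; split; last first.
  by rewrite -{1}P0 flow_nondecreasing// ltW.
apply/eqP => vE; apply: nx.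
apply: (characteristic_stationary A_posdef v_lipschitz L0 (Phi_char x) t0).
by rewrite P0.
Qed.

Lemma flow_crit x t : Crit v x -> 0 <= t -> Phi t x = x.
Proof.
move=> /(crit_constant_characteristic A) cx t0.
by rewrite -((Phi_semiflow.2 x).2 _ cx t t0).
Qed.

Lemma crit_limit_set : Crit v `<=` limit_set Phi.
Proof.
move=> x vx; apply: subset_closure; exists x => // T T0; apply: subset_closure.
by exists T => /=; [exact: lexx|exact: flow_crit].
Qed.

Lemma chain_recurrent_crit : dense [set r : R | regular_value v r] ->
  chain_recurrent Phi `<=` Crit v.
Proof.
move=> rdense x xCR; apply: contrapT => nx.
have sPhi := Phi_semiflow.1; have [Phi0 PhiD _] := sPhi.
have vx1 := flow_increasing ltr01 nx.
have [r [/=]] : `]v x, v (Phi 1 x)[ `&` [set r : R | regular_value v r] !=set0.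
  apply: rdense; last exact: interval_open.
  exists ((v x + v (Phi 1 x)) / 2) => /=.
  by rewrite in_itv/= midf_lt// midf_lt.
rewrite in_itv/= => /andP[xr rx] rreg.
have cv : continuous v.
  move=> y.
  suff main (e : R) : 0 < e -> \forall w \near y, `|v y - v w| <= e.
    exact/(@cvgrPdist_le _ _ _ (nbhs y) (nbhs_filter y)).
  move=> e0; apply/nbhs_normP; exists (e / (L + 1)) => /=.
    by rewrite divr_gt0// ltr_wpDl.
  move=> w; rewrite /= ltr_pdivlMr ?ltr_wpDl// => yw.
  rewrite (le_trans (v_lipschitz _ _))// (le_trans _ (ltW yw))// mulrC.
  by rewrite ler_wpM2l// lerDl.
pose N := [set y | r <= v y].
have clN : closed N.
  have -> : N = v @^-1` [set s | r <= s] by [].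
  by apply: preimage_closed => [y _|]; [exact: cv|exact: closed_ge].
have L1 : 0 < L + 1 by rewrite ltr_wpDl.
(* From a point [z] with [v z >= r], a jump shorter than [f z] lowers [v] by at most [v z - r]; the
   [+ 1] keeps the divisor positive. *)
pose f z := (v z - r) / (L + 1).
have cf : continuous f.
  move=> z; apply: (@cvgM _ _ (nbhs z)); last exact: cvg_cst.
  by apply: (@cvgB _ _ _ (nbhs z)); [exact: cv|exact: cvg_cst].
have f0 y : N y -> 0 < f (Phi 1 y).
  move=> ry; rewrite divr_gt0// subr_gt0.
  (* Above level [r] monotonicity suffices; on the level itself, regularity of [r] forces strict
     increase. *)
  have [ry'|ry'|ry'] := ltgtP r (v y).
  - by rewrite (lt_le_trans ry')// -{1}(Phi0 y) flow_nondecreasing.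
  - by move: ry; rewrite /N/= leNgt ry'.
  - by rewrite {1}ry'; apply: flow_increasing => //; apply: rreg.
have Pspeed y : `|Phi 1 y - y| <= S.
  have := characteristic_speed speed S0 (Phi_char y) (lexx 0) ler01.
  by rewrite Phi0 subr0 mulr1.
have [eps [ceps eps0 epsN]] := positive_continuous_minorant
  (semiflow_continuous sPhi ler01) cf clN Pspeed f0.
have [m m0 [xs [ts [xs0 xsm chain]]]] := xCR eps 2 ceps eps0 (ltr0n _ 2).
have key j : (j <= m)%N -> (0 < j)%N -> N (xs j).
  elim: j => // j IH jm _; have [tj xj] := chain j jm.
  (* The last unit of flow time is set apart so that the arrival point is the image under [Phi 1] of
     a point of [N]. For [j = 0] the remaining time is still at least 1, enough to lift [x] past
     level [r]. *)
  pose y := Phi (ts j - 1) (xs j).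
  have yE : Phi (ts j) (xs j) = Phi 1 y.
    by rewrite /y -PhiD ?subrKC//; lra.
  have Ny : N y.
    have [j0|j0] := posnP j.
      rewrite /y j0 xs0 /N/= (le_trans (ltW rx))// flow_nondecreasing//.
      by move: tj; rewrite j0; lra.
    rewrite /N/= (le_trans (IH (ltnW jm) j0))//= -{1}(Phi0 (xs j)).
    by rewrite flow_nondecreasing//; lra.
  move: xj; rewrite yE => /lt_le_trans /(_ (epsN y Ny)).
  rewrite ltr_pdivlMr// => xj.
  have : `|v (Phi 1 y) - v (xs j.+1)| <= v (Phi 1 y) - r.
    rewrite (le_trans (v_lipschitz _ _))// (le_trans _ (ltW xj))// mulrC.
    by rewrite ler_pM// ?norm_le_enorm// lerDl.
  by rewrite ler_norml /N/= => /andP[_]; lra.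
have := key m (leqnn m) m0.
by rewrite /N/= xsm leNgt xr.
Qed.

End LyapunovFlow.
End Recurrence.

Theorem mainTheorem1 (R : realType) (n : nat)
    (A : 'rV[R]_n -> 'M[R]_n) (V : 'rV[R]_n -> R)
    (A_periodic : Zn_periodic A)
    (A_C2 : forall i j : 'I_n, classC2 (fun x => A x i j))
    (A_posdef : forall x, sym_posdef (A x))
    (V_periodic : Zn_periodic V) (V_C2 : classC2 V)
    (V_max : (forall x, V x <= 0) /\ (exists x, V x = 0))
    (c : 'rV[R]_n) (u : 'rV[R]_n -> R)
    (u_solution :
      cell_solution (hamiltonian A V) c (mather_alpha (hamiltonian A V) c) u)
    (v : 'rV[R]_n -> R) (v_def : forall x, v x = dot c x + u x)
    (Phi : R -> 'rV[R]_n -> 'rV[R]_n)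
    (Phi_semiflow : characteristic_semiflow A v Phi)
    (regular_dense : dense [set r : R | regular_value v r]) :
  chain_recurrent Phi `<=` Crit v /\
  [/\ limit_set Phi = nonwandering Phi,
      nonwandering Phi = chain_recurrent Phi
    & chain_recurrent Phi = Crit v].
Proof.
have cA i j : continuous (fun x => A x i j) by exact: classC1_continuous (A_C2 i j).1.
have cV : continuous V by exact: classC1_continuous V_C2.1.
have [u_periodic [cu u_sub _]] := u_solution.
have [K K0 HK] := hamiltonian_coercive (mather_alpha (hamiltonian A V) c)
  A_periodic cA A_posdef V_periodic cV.
(* The viscosity subsolution inequality places [c + p] in a sublevel of the Hamiltonian, which is
   bounded by coercivity. *)
have [L L0 uL] : exists2 L : R, 0 <= L & forall x y, `|u x - u y| <= L * `|x - y|.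
  apply: (@superdiff_bounded_lipschitz _ _ u (K + `|c|)) => //.
    by rewrite addr_ge0.
  move=> x p /u_sub /HK cp; rewrite -(addrK c p) (addrC p).
  by rewrite (le_trans (ler_normB _ _))// lerD2r.
have vK x p : superdiff v x p -> `|p| <= K.
  by move=> /(superdiff_linear_perturb v_def)/u_sub/HK; rewrite subrKC.
have [M M0 AM] := mxapp_bounded A_periodic cA.
have speed x p : superdiff v x p -> `|mxapp (A x) p| <= M * K.
  by move=> /vK pK; rewrite (le_trans (AM x p))// ler_wpM2l.
have vL x y : `|v x - v y| <= (n%:R * `|c| + L) * `|x - y|.
  rewrite !v_def opprD addrACA -dotBr (le_trans (ler_normD _ _))// mulrDl lerD//.
  by rewrite -mulrA dot_norm.
have vL0 : 0 <= n%:R * `|c| + L by rewrite addr_ge0// mulr_ge0.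
have RC := chain_recurrent_crit A_posdef vL speed vL0 (mulr_ge0 M0 K0)
  Phi_semiflow regular_dense.
have CL := crit_limit_set Phi_semiflow.
have LO := limit_set_nonwandering Phi_semiflow.1.
have OR := nonwandering_chain_recurrent Phi_semiflow.1.
(* The inclusions [CL], [LO], [OR], [RC] form a cycle through the four sets, which are therefore
   equal. *)
split => //; split; apply/seteqP; split => // x.
- by move/OR/RC/CL.
- by move/RC/CL/LO.
- by move/CL/LO/OR.
Qed.
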